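(* Every nontrivial free group has a discrete lexicographic right order.
   Context: A right order on a group $G$ is a strict total order $<$ on the set $G$ such that $f<g$ implies $fh<gh$ for all $f,g,h\in G$. It is discrete if there is an element $a>1$ such that no element of $G$ lies strictly between $1$ and $a$. A subset $X$ of $G$ is convex if $x<y<z$ and $x,z\in X$ imply $y\in X$. A series for $G$ is a set $\Sigma=\{H_\lambda\mid\lambda\in\Lambda\}$ of subgroups, with $\Lambda$ totally ordered, such that $\lambda<\mu$ implies $H_\lambda\subset H_\mu$; $\{1\},G\in\Sigma$; $\Sigma$ is closed under arbitrary unions and intersections; and whenever $\mu$ immediately follows $\lambda$ in $\Lambda$, $H_\lambda$ is normal in $H_\mu$, with $H_\mu/H_\lambda$ then called a factor. A right order on $G$ is lexicographic if its convex subgroups form a series whose factors (with the induced order) are order isomorphic to subgroups of the additive group of reals. Free groups are not required to be finitely generated. *)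

(* Defs.v *)
From mathcomp Require Import all_boot all_algebra.
From mathcomp Require Import boolp classical_sets functions reals.

Set Implicit Arguments.
Unset Strict Implicit.
Unset Printing Implicit Defensive.

Local Open Scope classical_set_scope.
Local Open Scope group_scope.

(* X is a free basis: every map from X to a group extends uniquely to a
   homomorphism.  Maps from X are represented by the restrictions to X of
   functions defined on all of G. *)
Definition free_basis (G : groupType) (X : set G) : Prop :=
  forall (H : groupType) (f : G -> H),
    exists phi : {multiplicative G -> H},
      (forall x, X x -> phi x = f x) /\
      (forall psi : {multiplicative G -> H},
          (forall x, X x -> psi x = f x) -> forall g, psi g = phi g).

Definition free_group (G : groupType) : Prop :=
  exists X : set G, free_basis X.

Definition subgroup (G : groupType) (H : set G) : Prop := group_closed [in H].

Definition normal_in (G : groupType) (H K : set G) : Prop :=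
  H `<=` K /\ forall k h, K k -> H h -> H (h ^ k).

Section Orders.
Variable G : groupType.
Implicit Types (lt : G -> G -> Prop) (Sigma : set (set G)).

Definition strict_total_order lt : Prop :=
  [/\ forall x, ~ lt x x,
      forall x y z, lt x y -> lt y z -> lt x z
    & forall x y, [\/ lt x y, x = y | lt y x]].

Definition right_order lt : Prop :=
  strict_total_order lt /\ forall f g h, lt f g -> lt (f * h) (g * h).

Definition discrete_order lt : Prop :=
  exists2 a, lt 1 a & forall b, ~ (lt 1 b /\ lt b a).

Definition convex lt (X : set G) : Prop :=
  forall x y z, lt x y -> lt y z -> X x -> X z -> X y.

Definition convex_subgroups lt : set (set G) :=
  [set H | subgroup H /\ convex lt H].

(* K immediately follows H in Sigma ordered by inclusion. *)
Definition jump Sigma (H K : set G) : Prop :=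
  [/\ Sigma H, Sigma K, H `<` K
    & forall L, Sigma L -> ~ (H `<` L /\ L `<` K)].

(* A series is represented by its set of members, ordered by inclusion.  The
   union of the empty family is empty, hence not a subgroup, so closure under
   unions is required of nonempty families only; the intersection of the empty
   family is all of G. *)
Definition is_series Sigma : Prop :=
  [/\ forall H, Sigma H -> subgroup H,
      total_on Sigma subset,
      Sigma [set 1] /\ Sigma [set: G],
      (forall F : set (set G), F `<=` Sigma -> F !=set0 ->
         Sigma (\bigcup_(H in F) H)) /\
      (forall F : set (set G), F `<=` Sigma -> Sigma (\bigcap_(H in F) H))
    & forall H K, jump Sigma H K -> normal_in H K].

(* The factor K/H has the cosets H x, for x in K, as its elements, the
   elementwise product of cosets as its operation, and for H convex its
   induced order puts C before D when all of C lies before all of D. *)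
Definition coset (H : set G) (x : G) : set G := [set h * x | h in H].

Definition factor (K H : set G) : set (set G) := [set coset H x | x in K].

Definition coset_mul (C D : set G) : set G := [set c * d | c in C & d in D].

Definition coset_lt lt (C D : set G) : Prop :=
  forall c d, C c -> D d -> lt c d.

(* K/H is isomorphic, as an ordered group, to a subgroup A of (R, +). *)
Definition real_factor (R : realType) lt (K H : set G) : Prop :=
  exists (A : set R) (phi : set G -> R),
    [/\ zmod_closed [in A],
        set_bij (factor K H) A phi,
        forall C D, factor K H C -> factor K H D ->
          phi (coset_mul C D) = (phi C + phi D)%R
      & forall C D, factor K H C -> factor K H D ->
          coset_lt lt C D <-> (phi C < phi D)%R].

Definition lexicographic (R : realType) lt : Prop :=
  is_series (convex_subgroups lt) /\
  forall H K, jump (convex_subgroups lt) H K -> real_factor R lt K H.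

End Orders.

(* Main.v *)
(* Magnus embedding: sending a basis element x to 1 + x makes the free group G
   act unitriangularly by right multiplication on the integral power series in
   noncommuting variables indexed by G.  Well-order the monomials, with those
   starting with a fixed basis element a after all the others and shorter ones
   first within each of the two classes.  Right multiplication by g preserves
   the leading term of a series without constant term, so calling h larger than
   g when h - g has a positive leading coefficient defines a right order.  Its
   jumps are cut out by the coefficients of g - 1 at single monomials, whence
   factors isomorphic to subgroups of Z.  The smallest nontrivial convex
   subgroup belongs to the monomial a and is the cyclic group generated by a,
   because in a reduced product a^e x1^e1 ... xk^ek (x1 <> a) the monomial
   x1 ... xk has coefficient e1 ... ek <> 0. *)
Require Import Defs.
From HB Require Import structures.
From mathcomp Require Import all_boot all_order all_algebra.
From mathcomp Require Import boolp wochoice classical_sets reals.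
From mathcomp Require Import zify.

Set Implicit Arguments.
Unset Strict Implicit.
Unset Printing Implicit Defensive.

Import Order.TTheory GRing.Theory Num.Theory.

Local Open Scope classical_set_scope.
Local Open Scope group_scope.

(** * Well-orders *)

Section StrictWellOrder.
Variable T : Type.
Implicit Type prec : T -> T -> Prop.

Definition strict_well_order prec :=
  [/\ forall x, ~ prec x x,
      forall x y z, prec x y -> prec y z -> prec x z
    & forall A : set T, A !=set0 ->
        exists2 x, A x & forall y, A y -> x = y \/ prec x y].

Lemma strict_well_order_total prec : strict_well_order prec ->
  forall x y, [\/ prec x y, x = y | prec y x].
Proof.
case=> _ _ min x y; have [|z zxy zle] := min [set x; y]; first by exists x; left.
have [zx zy] : (z = x \/ prec z x) /\ (z = y \/ prec z y).
  by split; apply: zle; [left|right].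
by case: zxy => zE; rewrite zE in zx zy; [case: zy => ?|case: zx => [<-|?]];
  constructor.
Qed.

Definition rank_lex (rank : T -> nat) prec x y :=
  (rank x < rank y)%N \/ rank x = rank y /\ prec x y.

Lemma rank_lex_well_order (rank : T -> nat) prec :
  strict_well_order prec -> strict_well_order (rank_lex rank prec).
Proof.
move=> [irr tr min]; split=> [x [|[_ /irr //]]|x y z|A [x0 Ax0]].
- by rewrite ltnn.
- move=> [xy|[exy xy]] [yz|[eyz yz]].
  + by left; apply: ltn_trans yz.
  + by left; rewrite -eyz.
  + by left; rewrite exy.
  + by right; rewrite exy eyz; split=> //; apply: tr yz.
- pose P n := `[< exists2 x, A x & rank x = n >].
  have exP : exists n, P n by exists (rank x0); apply/asboolP; exists x0.
  case: (ex_minnP exP) => n /asboolP[x Ax rx] nmin.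
  have [|y [Ay ry] ymin] := min [set y | A y /\ rank y = n]; first by exists x.
  exists y => // z Az; have : P (rank z) by apply/asboolP; exists z.
  move/nmin; rewrite leq_eqVlt => /orP[/eqP nz|nz]; last first.
    by right; left; rewrite ry.
  by have [|->|yz] := ymin z; [|left|right; right; rewrite ry].
Qed.

End StrictWellOrder.

(** The well-ordering principle only yields unique minima of nonempty sets; reflexivity,
    antisymmetry and transitivity come from the minima of sets of one, two and three elements. *)
Lemma exists_strict_well_order (T : eqType) :
  exists prec : T -> T -> Prop, strict_well_order prec.
Proof.
have [R wR] := well_ordering_principle T.
have Rmin (A : set T) : A !=set0 -> exists2 x, A x & forall y, A y -> R x y.
  move=> [x Ax]; have [|z [[zA zmin] _]] := wR [pred x | `[< A x >]].
    by exists x; apply/asboolP.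
  by exists z => [|y Ay]; [apply/asboolP|apply: zmin; apply/asboolP].
have Rxx x : R x x by have [|y -> /(_ x)] := Rmin [set x]; [exists x|apply].
have Ranti x y : R x y -> R y x -> x = y.
  move=> xy yx; have [|z [_ uz]] := wR (pred2 x y).
    by exists x; rewrite inE eqxx.
  suff : minimum_of R (pred2 x y) x /\ minimum_of R (pred2 x y) y.
    by move=> [/uz zx /uz zy]; rewrite -zx.
  by split; split=> [|u]; rewrite !inE ?eqxx ?orbT // => /orP[] /eqP ->.
exists (fun x y => R x y /\ x <> y); split=> [x [] //|x y z|A A0]; last first.
  have [x Ax xmin] := Rmin A A0; exists x => // y /xmin xy.
  by have [->|/eqP] := eqVneq x y; [left|right].
move=> [xy nxy] [yz nyz].
have [|u uxyz umin] := Rmin [set x; y; z]; first by exists x; do 2 left.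
have [ux uy uz] : [/\ R u x, R u y & R u z].
  by split; apply: umin; [left; left|left; right|right].
case: uxyz => [[]|] uE; rewrite uE in ux uy uz.
- by split=> // xz; apply: nyz; apply: Ranti; rewrite // -xz.
- by case: nxy; apply: Ranti.
- by case: nyz; apply: Ranti.
Qed.

(** * Subgroups given as sets *)

Lemma subgroupP (G : groupType) (H : set G) :
  subgroup H <-> H 1 /\ forall x y, H x -> H y -> H (x / y).
Proof.
split=> -[H1 HD]; split; try by move: H1; rewrite ?inE.
- by move=> x y /mem_set Hx /mem_set Hy; have := HD _ _ Hx Hy; rewrite inE.
- by move=> x y; rewrite !inE => Hx Hy; exact: HD.
Qed.

Section Subgroup.
Variables (G : groupType) (H : set G).
Hypothesis sgH : subgroup H.

Lemma subgroup1 : H 1. Proof. by have /subgroupP[] := sgH. Qed.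

Lemma subgroup_div x y : H x -> H y -> H (x / y).
Proof. by have /subgroupP[_] := sgH; apply. Qed.

Lemma subgroupV x : H x -> H x^-1.
Proof. by move=> Hx; rewrite -div1g; apply: subgroup_div => //; apply: subgroup1. Qed.

Lemma subgroupM x y : H x -> H y -> H (x * y).
Proof.
by move=> Hx /subgroupV Hy; rewrite -[y]invgK; apply: subgroup_div.
Qed.

Lemma subgroupX x n : H x -> H (x ^+ n).
Proof.
by move=> Hx; elim: n => [|n IH]; [rewrite expg0; apply: subgroup1|
  rewrite expgSr; apply: subgroupM].
Qed.

End Subgroup.

(** * Right orders from leading coefficients *)

(* [c g] plays the role of the coordinates of [w * g - w], for a fixed vector
   [w] of a right [G]-module with well-ordered coordinates on which [G] acts
   unitriangularly. *)
Section ValuedCocycle.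
Variables (G : groupType) (I : Type) (prec : I -> I -> Prop) (c : G -> I -> int).

Definition vanishes_below g i := forall j, prec j i -> c g j = 0%R.

Definition vanishes_upto g i := vanishes_below g i /\ c g i = 0%R.

Definition cocycle_pos g := exists2 i, vanishes_below g i & (0 < c g i)%R.

(** [h / g] is unchanged when both elements are multiplied on the right by a third, so right
    invariance is built in. *)
Definition cocycle_lt g h := cocycle_pos (h / g).

Hypothesis wo : strict_well_order prec.
(** In the model, [w * g * h - w = (w * g - w) * h + (w * h - w)], and [h] preserves the coordinate
    at [i] of a vector vanishing below [i]. *)
Hypothesis cM : forall g h i, vanishes_below g i ->
  c (g * h) i = (c g i + c h i)%R.
Hypothesis c_inj : forall g, (forall i, c g i = 0%R) -> g = 1.

Let prec_irr i : ~ prec i i. Proof. by have [+ _ _] := wo; apply. Qed.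

Let prec_trans i j k : prec i j -> prec j k -> prec i k.
Proof. by have [_ + _] := wo; apply. Qed.

(** For one element this gives its leading coefficient; for a pair, an index below which both vanish
    and at which at least one does not. *)
Lemma first_nonzero (A : set G) : (exists2 g, A g & g <> 1) ->
  exists2 i, (exists2 g, A g & c g i <> 0%R) &
    forall g, A g -> vanishes_below g i.
Proof.
move=> [g Ag g1]; have [_ _ min] := wo.
have [|i [h Ah chi] imin] := min [set i | exists2 h, A h & c h i <> 0%R].
  by apply: contra_notP g1 => /forallNP nA; apply: c_inj => i;
    apply: contra_notP (nA i) => ?; exists g.
exists i; first by exists h.
move=> k Ak j ji; apply: contra_notP (@prec_irr j) => ckj.
have [|ij|ij] := imin j; first by exists k.
  by move: ji; rewrite ij.
exact: prec_trans ij.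
Qed.

Lemma leading g : g <> 1 -> exists2 i, vanishes_below g i & c g i <> 0%R.
Proof.
move=> g1; have [|i [h -> cgi] /(_ g) gi] := @first_nonzero [set g]; first by exists g.
by exists i => //; apply: gi.
Qed.

Lemma vanishes_below_le g i j : vanishes_below g i -> prec j i ->
  vanishes_below g j.
Proof. by move=> gi ji k kj; apply: gi; apply: prec_trans ji. Qed.

(** At the least index [j] with a nonzero value, additivity for [1 * 1] would give
    [c 1 j = c 1 j + c 1 j]. *)
Lemma cocycle1 i : c 1 i = 0%R.
Proof.
have [_ _ min] := wo; apply: contrapT => c1i.
have [|j c1j jmin] := min [set i | c 1 i <> 0%R]; first by exists i.
have : c (1 * 1) j = (c 1 j + c 1 j)%R.
  apply: cM => k kj; apply: contrapT => /jmin[jk|jk]; apply: (@prec_irr j).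
    by move: kj; rewrite -jk.
  exact: prec_trans kj.
by rewrite mulg1 => /eqP; rewrite addrC -subr_eq subrr => /eqP/esym.
Qed.

Lemma cocycleV g i : vanishes_below g i -> c g^-1 i = (- c g i)%R.
Proof.
move=> gi; have := cM g^-1 gi.
by rewrite mulgV cocycle1 => /esym/eqP; rewrite addrC addr_eq0 => /eqP.
Qed.

Lemma vanishes_belowV g i : vanishes_below g i -> vanishes_below g^-1 i.
Proof.
move=> gi j ji; rewrite cocycleV ?gi ?oppr0 //.
exact: vanishes_below_le ji.
Qed.

Lemma vanishes_belowM g h i :
  vanishes_below g i -> vanishes_below h i -> vanishes_below (g * h) i.
Proof.
move=> gi hi j ji; rewrite cM ?gi ?hi ?addr0 //.
exact: vanishes_below_le ji.
Qed.

Lemma cocycle_div g h i : vanishes_below g i -> vanishes_below h i ->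
  c (g / h) i = (c g i - c h i)%R.
Proof. by move=> gi hi; rewrite cM // cocycleV. Qed.

Lemma vanishes_belowX g i n : vanishes_below g i -> vanishes_below (g ^+ n) i.
Proof.
move=> gi; elim: n => [|n IH]; first by rewrite expg0 => j _; apply: cocycle1.
by rewrite expgSr; apply: vanishes_belowM.
Qed.

Lemma cocycleX g i n : vanishes_below g i -> c (g ^+ n) i = (c g i *+ n)%R.
Proof.
move=> gi; elim: n => [|n IH]; first by rewrite expg0 cocycle1.
by rewrite expgSr cM ?IH ?mulrSr //; apply: vanishes_belowX.
Qed.

Lemma cocycle_posP g i : vanishes_below g i -> c g i <> 0%R ->
  cocycle_pos g <-> (0 < c g i)%R.
Proof.
move=> gi cgi; split=> [[j gj cgj]|]; last by exists i.
by have [/gj//|->//|/gi cgj0] := strict_well_order_total wo i j; rewrite cgj0 in cgj.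
Qed.

Lemma cocycle_pos_ge0 g i : vanishes_below g i -> cocycle_pos g ->
  (0 <= c g i)%R.
Proof.
move=> gi gpos; have [->//|/eqP cgi] := eqVneq (c g i) 0%R.
by apply: ltW; apply/(cocycle_posP gi).
Qed.

Lemma cocycle_pos1 : ~ cocycle_pos 1.
Proof. by move=> [i _]; rewrite cocycle1. Qed.

Lemma cocycle_posM g h : cocycle_pos g -> cocycle_pos h -> cocycle_pos (g * h).
Proof.
move=> [i gi cgi] [j hj chj].
have [ij|ij|ji] := strict_well_order_total wo i j.
- have hi := vanishes_below_le hj ij; exists i; first exact: vanishes_belowM.
  by rewrite cM // (hj i) // addr0.
- rewrite -{j}ij in hj chj; exists i; first exact: vanishes_belowM.
  by rewrite cM // addr_gt0.
- have gj := vanishes_below_le gi ji; exists j; first exact: vanishes_belowM.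
  by rewrite cM // (gi j) // add0r.
Qed.

Lemma cocycle_pos_total g : g <> 1 -> cocycle_pos g \/ cocycle_pos g^-1.
Proof.
move=> /leading[i gi /eqP]; rewrite neq_lt => /orP[] cgi; [right|left]; exists i => //.
  exact: vanishes_belowV.
by rewrite cocycleV // oppr_gt0.
Qed.

Lemma cocycle_right_order : right_order cocycle_lt.
Proof.
split; last by move=> f g h; rewrite /cocycle_lt invgM mulgA mulgK.
split=> [x|x y z xy yz|x y].
- by rewrite /cocycle_lt divgg; apply: cocycle_pos1.
- by have := cocycle_posM yz xy; rewrite mulgA mulgVK.
- have [->|xy] := EM (x = y); first exact: Or32.
  have [|yx|] := @cocycle_pos_total (y / x); [|exact: Or31|].
    by move=> yx; apply: xy; rewrite -[y](mulgVK x) yx mul1g.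
  by rewrite invgM invgK => ?; apply: Or33.
Qed.

(* Coefficients are integers, so [h] lies between [g ^- n] and [g ^+ n] for
   large [n]. *)
Lemma convex_subgroup_leading H g h i : convex_subgroups cocycle_lt H ->
  H g -> vanishes_below g i -> c g i <> 0%R -> vanishes_below h i -> H h.
Proof.
move=> [sgH cvxH]; wlog cgi : g / (0 < c g i)%R => [wl Hg gi /eqP|].
  rewrite neq_lt => /orP[cgi hi|cgi].
    have gVi := vanishes_belowV gi; have cgV := cocycleV gi.
    by apply: (wl g^-1) => //; [lia|exact: subgroupV|lia].
  apply: (wl g) => //; lia.
move=> Hg gi _ hi; pose n := `|c h i|%N.+1.
have gni := vanishes_belowX n gi; have cgn := cocycleX n gi.
have ge_n : (`|c h i| < c (g ^+ n) i)%R.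
  rewrite cgn -mulr_natr; apply: (@lt_le_trans _ _ (1 * n%:R)%R); first by lia.
  by rewrite ler_wpM2r //; lia.
have Hgn : H (g ^+ n) by exact: subgroupX.
apply: (cvxH (g ^+ n)^-1 h (g ^+ n)) => //.
- exists i; first by rewrite invgK; apply: vanishes_belowM.
  by rewrite invgK cM //; lia.
- exists i; last by rewrite cocycle_div //; lia.
  by apply: vanishes_belowM => //; apply: vanishes_belowV.
- exact: subgroupV.
Qed.

(** At the first index where [g] or [h] is nonzero, the one that is nonzero pulls the other into its
    own subgroup. This pointwise form gives both comparability and closure under unions. *)
Lemma convex_subgroups_total H K g h :
    convex_subgroups cocycle_lt H -> convex_subgroups cocycle_lt K ->
  H g -> K h -> K g \/ H h.
Proof.
move=> cH cK Hg Kh; have [->|g1] := EM (g = 1); first by left; apply: subgroup1 cK.1.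
have [|i [_ [->|->] ci] vi] := @first_nonzero [set g; h].
- by exists g; [left|].
- by right; apply: (convex_subgroup_leading cH Hg _ ci); apply: vi; [left|right].
- by left; apply: (convex_subgroup_leading cK Kh _ ci); apply: vi; [right|left].
Qed.

Lemma convex_subgroups_bigcup F : F `<=` convex_subgroups cocycle_lt -> F !=set0 ->
  convex_subgroups cocycle_lt (\bigcup_(H in F) H).
Proof.
move=> sF [H0 F0].
have common x y : (\bigcup_(H in F) H) x -> (\bigcup_(H in F) H) y ->
    exists2 H, F H & H x /\ H y.
  move=> [H FH Hx] [K FK Ky].
  by have [] := convex_subgroups_total (sF _ FH) (sF _ FK) Hx Ky => ?;
    [exists K|exists H].
split.
  apply/subgroupP; split=> [|x y Ux Uy]; first by exists H0 => //; apply: subgroup1 (sF _ F0).1.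
  have [H FH [Hx Hy]] := common _ _ Ux Uy.
  by exists H => //; apply: subgroup_div (sF _ FH).1 _ _ _ _.
move=> x y z xy yz Ux Uz; have [H FH [Hx Hz]] := common _ _ Ux Uz.
by exists H => //; apply: (sF _ FH).2 xy yz _ _.
Qed.

(** Suppose [x < y < z] and [y] leads at some [i] in [D]. Then [y / x] and [z / y] have coefficients
    [c y i] and [- c y i] at [i], and both must be nonnegative. *)
Lemma vanishing_convex (D : set I) : (forall i j, D i -> prec j i -> D j) ->
  convex_subgroups cocycle_lt [set g | forall i, D i -> c g i = 0%R].
Proof.
move=> Dlow; have Dbelow g i : (forall i, D i -> c g i = 0%R) -> D i -> vanishes_below g i.
  by move=> gD Di j ji; apply: gD; apply: Dlow ji.
split.
  apply/subgroupP; split=> [i _|x y xD yD i Di]; first exact: cocycle1.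
  by rewrite cocycle_div ?xD ?yD ?subrr //; apply: Dbelow.
move=> x y z xy yz xD zD i0 Di0; apply: contrapT => cyi0.
have [y1|i yi cyi] := @leading y.
  by apply: cyi0; rewrite y1 cocycle1.
have Di : D i.
  by have [/Dlow|->|/yi] := strict_well_order_total wo i i0; [apply| |].
have [xi zi] : vanishes_below x i /\ vanishes_below z i by split; apply: Dbelow.
have /cocycle_pos_ge0/(_ xy) : vanishes_below (y / x) i.
  by apply: vanishes_belowM => //; apply: vanishes_belowV.
have /cocycle_pos_ge0/(_ yz) : vanishes_below (z / y) i.
  by apply: vanishes_belowM => //; apply: vanishes_belowV.
by rewrite !cocycle_div // xD // zD //; lia.
Qed.

Lemma vanishes_below_convex i :
  convex_subgroups cocycle_lt [set g | vanishes_below g i].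
Proof. by apply: vanishing_convex => j k /[swap]; apply: prec_trans. Qed.

Lemma vanishes_upto_convex i :
  convex_subgroups cocycle_lt [set g | vanishes_upto g i].
Proof.
suff <- : [set g | forall j, prec j i \/ j = i -> c g j = 0%R] =
    [set g | vanishes_upto g i].
  by apply: (@vanishing_convex [set j | prec j i \/ j = i]) => j k /= [ji|->] kj; left => //; apply: prec_trans ji.
apply/seteqP; split=> g /= gi; first by split=> [j ji|]; apply: gi; [left|right].
by case: gi => gi cgi j [/gi|->].
Qed.

(** Let [i] be the leading index of some [g] in [K] outside [H]. Then [K] contains everything
    vanishing below [i], and [H] lies in [vanishes_upto] at [i], as otherwise it would contain [g].
    Nothing fits strictly between, so both inclusions are equalities. *)
Lemma cocycle_jump H K : jump (convex_subgroups cocycle_lt) H K ->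
  exists i, H = [set g | vanishes_upto g i] /\ K = [set g | vanishes_below g i].
Proof.
move=> [cH cK [sHK /existsNP[g /not_implyP[Kg nHg]]] nL].
have [g1|i gi cgi] := @leading g; first by case: nHg; rewrite g1; apply: subgroup1 cH.1.
have sVK : [set g | vanishes_below g i] `<=` K.
  by move=> h; apply: convex_subgroup_leading Kg gi cgi.
have sHV : H `<=` [set g | vanishes_upto g i].
  move=> h Hh; have [->|h1] := EM (h = 1); first by split=> [j|]; rewrite cocycle1.
  have [j hj chj] := leading h1.
  have [ij|ij|ji] := strict_well_order_total wo i j.
  - by split; [apply: vanishes_below_le ij|apply: hj].
  - by case: nHg; rewrite -ij in hj chj; apply: (convex_subgroup_leading cH Hh hj chj).
  - case: nHg; apply: (convex_subgroup_leading cH Hh hj chj).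
    exact: vanishes_below_le ji.
exists i; split.
  apply: contrapT => HV; apply: (nL _ (vanishes_upto_convex i)); split.
    by split=> // sVH; apply: HV; apply/seteqP.
  by split=> [h [hi _]|/(_ g Kg) [_ /cgi//]]; apply: sVK.
apply: contrapT => KV; apply: (nL _ (vanishes_below_convex i)); split.
  by split=> [h /sHV[]//|/(_ g gi)].
by split=> // sKV; apply: KV; apply/seteqP.
Qed.

Lemma cocycle_series : is_series (convex_subgroups cocycle_lt).
Proof.
have [[irr _ _] _] := cocycle_right_order.
split.
- by move=> H [].
- move=> H K cH cK; have [|/existsNP[g /not_implyP[Hg nKg]]] := EM (H `<=` K); first by left.
  by right=> h Kh; have [] := convex_subgroups_total cH cK Hg Kh.
- split; split=> //.
  + apply/subgroupP; split=> // x y -> ->; exact: divgg.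
  + move=> x y z xy yz x1 z1; rewrite x1 in xy; rewrite z1 in yz.
    have [[_ tr _] _] := cocycle_right_order.
    by have /irr := tr _ _ _ xy yz.
  + exact/subgroupP.
- split=> [|F sF]; first exact: convex_subgroups_bigcup.
  split.
    apply/subgroupP; split=> [H /sF[/subgroup1//]|x y xF yF H FH].
    by have [sgH _] := sF _ FH; apply: subgroup_div => //; [apply: xF|apply: yF].
  move=> x y z xy yz xF zF H FH.
  by have [_ cvxH] := sF _ FH; apply: cvxH xy yz _ _; [apply: xF|apply: zF].
- move=> H K jHK; split; first by case: jHK => _ _ [].
  have [i [-> ->]] := cocycle_jump jHK => k h ki [hi chi].
  have kVi := vanishes_belowV ki.
  split; first by apply: vanishes_belowM => //; apply: vanishes_belowM.
  (* The conjugate has coefficient [- c k i + c h i + c k i] at [i]. *)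
  by rewrite cM // cM // cocycleV // chi add0r addNr.
Qed.

Lemma cocycle_lexicographic (R : realType) : lexicographic R cocycle_lt.
Proof.
split; first exact: cocycle_series.
move=> H K /cocycle_jump[i [-> ->]]; set V := [set g | vanishes_below g i].
set N := [set g | vanishes_upto g i].
have sgN : subgroup N by have [] := vanishes_upto_convex i.
have sgV : subgroup V by have [] := vanishes_below_convex i.
(* Any representative serves, since the coefficient at [i] is constant on cosets of [N] in [V]. *)
pose phi (C : set G) : R := (c (xget 1%g C) i)%:~R%R.
have phiE (C : set G) n : C !=set0 -> (forall x, C x -> c x i = n) -> phi C = n%:~R%R.
  by move=> [x Cx] Cn; congr (_%:~R)%R; apply: Cn; case: xgetP => // /(_ x).
have cosetP x : coset N x x by exists 1; rewrite ?mul1g //; apply: (subgroup1 sgN).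
have cosetV x y : V x -> coset N x y -> V y /\ c y i = c x i.
  move=> xi [h [hi chi] <-]; split; first exact: vanishes_belowM.
  by rewrite cM // chi add0r.
have phi_coset x : V x -> phi (coset N x) = (c x i)%:~R%R.
  by move=> xi; apply: phiE => [|y /(cosetV _ _ xi)[]//]; exists x.
have coset_sub x y : V x -> V y -> c x i = c y i -> coset N x `<=` coset N y.
  move=> xi yi cxy _ [h Nh <-]; exists (h * (x / y)); last by rewrite -mulgA mulgVK.
  apply: (subgroupM sgN) => //; split; first exact: (subgroup_div sgV).
  by rewrite cocycle_div // cxy subrr.
have coset_eq x y : V x -> V y -> c x i = c y i -> coset N x = coset N y.
  by move=> xi yi cxy; apply/seteqP; split; apply: coset_sub.
exists [set (c x i)%:~R%R | x in V], phi; split.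
- split; rewrite ?inE.
    by exists 1; [apply: (subgroup1 sgV)|rewrite cocycle1].
  move=> u v /[!inE] -[x xi <-] [y yi <-]; exists (x / y); first exact: (subgroup_div sgV).
  by rewrite cocycle_div // intrB.
- split.
  + by move=> _ [x xi <-]; exists x => //; rewrite phi_coset.
  + move=> C D /[!inE] -[x xi <-] [y yi <-].
    by rewrite !phi_coset // => /intr_inj cxy; apply: coset_eq.
  + by move=> _ [x xi <-]; exists (coset N x); [exists x|rewrite phi_coset].
- move=> _ _ [x xi <-] [y yi <-]; rewrite !phi_coset // -intrD; apply: phiE.
    by exists (x * y); exists x => //; exists y.
  move=> _ [u /(cosetV _ _ xi)[ui <-]] [v /(cosetV _ _ yi)[vi <-] <-].
  by rewrite cM.
- move=> _ _ [x xi <-] [y yi <-]; rewrite !phi_coset // ltr_int; split=> [ltxy|ltxy].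
    have lt_xy := ltxy _ _ (cosetP x) (cosetP y).
    have := cocycle_pos_ge0 (subgroup_div sgV yi xi) lt_xy.
    rewrite cocycle_div // subr_ge0 le_eqVlt => /orP[/eqP cxy|//].
    (* Equal coefficients make the two cosets equal, and then [x] would precede itself. *)
    have : cocycle_lt x x.
      by apply: ltxy; rewrite // -(coset_eq _ _ xi yi cxy).
    by rewrite /cocycle_lt divgg => /cocycle_pos1.
  move=> u v /(cosetV _ _ xi)[ui cu] /(cosetV _ _ yi)[vi cv].
  exists i; first exact: (subgroup_div sgV).
  by rewrite cocycle_div // cu cv subr_gt0.
Qed.

(** Here [i] is the last possible leading index. If [1 < b < a], then [b] cannot lead after [i];
    leading before [i] makes [a / b] negative; leading at [i] forces [c b i = 1], whence
    [a / b = 1]. *)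
Lemma cocycle_discrete a i : vanishes_below a i -> c a i = 1%R ->
  (forall g, vanishes_upto g i -> g = 1) -> discrete_order cocycle_lt.
Proof.
move=> ai ca upto1; exists a; first by exists i; rewrite invg1 mulg1 ?ca.
move=> b; rewrite /cocycle_lt invg1 mulg1 => -[[j bj cb] ab].
have [ij|ij|ji] := strict_well_order_total wo i j.
- have b1 : b = 1 by apply: upto1; split; [apply: vanishes_below_le ij|apply: bj].
  by move: cb; rewrite b1 cocycle1.
- rewrite -{j}ij in bj cb.
  have abi : vanishes_below (a / b) i by apply: vanishes_belowM => //; apply: vanishes_belowV.
  have ab_ge0 := cocycle_pos_ge0 abi ab; rewrite cocycle_div // ca in ab_ge0.
  have ab1 : a / b = 1 by apply: upto1; split=> //; rewrite cocycle_div // ca; lia.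
  by move: ab; rewrite ab1 => /cocycle_pos1.
- have aj := vanishes_below_le ai ji.
  have /cocycle_pos_ge0/(_ ab) : vanishes_below (a / b) j.
    by apply: vanishes_belowM => //; apply: vanishes_belowV.
  by rewrite cocycle_div // (ai j) //; lia.
Qed.

End ValuedCocycle.

(** * Free groups and the Magnus action *)

Section SubgroupType.
Variables (G : groupType) (H : set G).

(* The proof is an argument so that the group structure can be inferred. *)
Definition subgroup_type of subgroup H : Type := {g : G | g \in H}.

Variable sgH : subgroup H.

HB.instance Definition _ :=
  [isSub of subgroup_type sgH for @sval G (fun g => g \in H)].
HB.instance Definition _ := [Choice of subgroup_type sgH by <:].
HB.instance Definition _ :=
  SubChoice_isSubGroup.Build G [in H] (subgroup_type sgH) sgH.

End SubgroupType.

(** Extend the inclusion of [X] in [H] to a homomorphism from [G] to [H]. Followed by the inclusion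
    of [H] in [G] it fixes [X], so by uniqueness it is the identity. *)
Lemma free_basis_generates (G : groupType) (X H : set G) :
  free_basis X -> subgroup H -> X `<=` H -> forall g, H g.
Proof.
move=> freeX sgH sXH g; pose K : groupType := subgroup_type sgH.
have [phi [phiX _]] := freeX K (fun x => insubd (1 : K) x).
have [psi [_ psi_uniq]] := freeX G id.
pose valphi : {multiplicative G -> G} := (val : K -> G) \o phi.
have valphiX x : X x -> valphi x = x.
  by move=> Xx; rewrite /= phiX // insubdK //; apply/mem_set/sXH.
have -> : g = valphi g.
  by rewrite (psi_uniq _ valphiX); apply: (psi_uniq idfun).
exact/set_mem/(valP (phi g)).
Qed.

Lemma free_basis_ind (G : groupType) (X : set G) (P : G -> Prop) :
  free_basis X -> P 1 ->
  (forall g x, X x -> P g -> P (g * x)) ->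
  (forall g x, X x -> P g -> P (g * x^-1)) ->
  forall g, P g.
Proof.
move=> freeX P1 PM PV g.
(* Asking for [h] and [h^-1] together makes this set closed under division. *)
pose H := [set h | forall k, P k -> P (k * h) /\ P (k * h^-1)].
have sgH : subgroup H.
  apply/subgroupP; split=> [k|x y Hx Hy k Pk]; first by rewrite invg1 !mulg1.
  rewrite invgM invgK !mulgA; split.
    by apply: (Hy _ _).2; apply: (Hx _ _).1.
  by apply: (Hx _ _).2; apply: (Hy _ _).1.
have XH : X `<=` H by move=> x Xx k Pk; split; [apply: PM|apply: PV].
by have [] := free_basis_generates freeX sgH XH g 1 P1; rewrite mul1g.
Qed.

(** * The group of bijections of a type *)

Section Bijections.
Variable T : Type.

Record bijection := Bijection {
  fwd : T -> T;
  bwd : T -> T;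
  fwdK : cancel fwd bwd;
  bwdK : cancel bwd fwd }.

Lemma bijection_eq (f g : bijection) : fwd f =1 fwd g -> f = g.
Proof.
case: f g => f f' fK f'K [g g' gK g'K] /= /funext fg; subst g.
have ? : f' = g' by apply/funext => x; rewrite -{1}[x]g'K fK.
by subst g'; congr Bijection; apply: Prop_irrelevance.
Qed.

HB.instance Definition _ := gen_eqMixin bijection.
HB.instance Definition _ := gen_choiceMixin bijection.

Definition bijection1 := @Bijection id id (fun=> erefl) (fun=> erefl).

Definition bijectionV f := Bijection (@bwdK f) (@fwdK f).

(* Products are composed from left to right, as for right actions. *)
Definition bijectionM f g :=
  Bijection (can_comp (@fwdK g) (@fwdK f)) (can_comp (@bwdK f) (@bwdK g)).

Lemma bijectionA : associative bijectionM.
Proof. by move=> f g h; apply: bijection_eq. Qed.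

Lemma bijection1M : left_id bijection1 bijectionM.
Proof. by move=> f; apply: bijection_eq. Qed.

Lemma bijectionM1 : right_id bijection1 bijectionM.
Proof. by move=> f; apply: bijection_eq. Qed.

Lemma bijectionVM : left_inverse bijection1 bijectionV bijectionM.
Proof. by move=> f; apply: bijection_eq => x /=; rewrite bwdK. Qed.

Lemma bijectionMV : right_inverse bijection1 bijectionV bijectionM.
Proof. by move=> f; apply: bijection_eq => x /=; rewrite fwdK. Qed.

HB.instance Definition _ := isGroup.Build bijection
  bijectionA bijection1M bijectionM1 bijectionVM bijectionMV.

End Bijections.

(** * Unitriangular operators on power series *)

Section Transvections.
Variable T : eqType.
Implicit Types (v w : seq T -> int) (u : seq T).

(* A function [v] on words is a formal power series in noncommuting variables,
   words being read backwards; [transvection x] is right multiplication by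
   [1 + x]. *)
Definition transvection x v u : int :=
  if u is y :: u' then (v u + (if x == y then v u' else 0))%R else v u.

(** Right multiplication by [1 - x + x^2 - ...], obtained by solving [w * (1 + x) = v] for [w]
    letter by letter. *)
Fixpoint transvectionV x v u : int :=
  if u is y :: u' then (v u - (if x == y then transvectionV x v u' else 0))%R
  else v u.

Lemma transvectionK x : cancel (transvection x) (transvectionV x).
Proof.
by move=> v; apply/funext; elim=> [|y u IH] //=; rewrite IH addrK.
Qed.

Lemma transvectionVK x : cancel (transvectionV x) (transvection x).
Proof. by move=> v; apply/funext; case=> [|y u] //=; rewrite subrK. Qed.

Definition suffix_agree v w u := forall k, v (drop k u) = w (drop k u).

(** Unitriangularity along initial segments of monomials, which are suffixes of reversed words. It
    compares two series because the elements of [bijection] are arbitrary maps, not assumed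
    linear. *)
Definition unipotent (F : (seq T -> int) -> seq T -> int) :=
  (forall v, F v [::] = v [::]) /\
  forall v w y u, suffix_agree v w u ->
    (F v (y :: u) - F w (y :: u) = v (y :: u) - w (y :: u))%R.

Lemma unipotent_agree F v w u : unipotent F ->
  suffix_agree v w u -> suffix_agree (F v) (F w) u.
Proof.
move=> [F0 FS]; elim: u => [|y u IH] vw k; first by rewrite !F0; apply: (vw 0%N).
have vwu : suffix_agree v w u by move=> j; apply: (vw j.+1).
case: k => [|k]; last exact: IH.
by apply/eqP; rewrite -subr_eq0 FS // (vw 0%N) subrr.
Qed.

Lemma unipotent_comp F F' : unipotent F -> unipotent F' -> unipotent (F' \o F).
Proof.
move=> uF [F'0 F'S]; have [F0 FS] := uF; split=> [v|v w y u vw] /=.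
  by rewrite F'0.
by rewrite F'S ?FS //; apply: unipotent_agree.
Qed.

Lemma transvection_unipotent x : unipotent (transvection x).
Proof.
split=> // v w y u vw; have := vw 0%N; rewrite drop0 /= => ->.
by case: ifP => _; lia.
Qed.

Lemma transvectionV_unipotent x : unipotent (transvectionV x).
Proof.
split=> // v w y u vw /=; suff -> : transvectionV x v u = transvectionV x w u by lia.
elim: u vw => [|z u IH] vw; first exact: (vw 0%N).
by have := vw 0%N; rewrite /= => ->; rewrite IH // => k; apply: (vw k.+1).
Qed.

End Transvections.

(** * Homomorphisms and integer powers *)

Section Multiplicative.
Variables (G H : groupType) (phi : {multiplicative G -> H}).

Lemma multiplicative1 : phi 1 = 1.
Proof. by rewrite -[LHS](mulgK (phi 1)) -gmulfM mulg1 mulgV. Qed.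

Lemma multiplicativeV g : phi g^-1 = (phi g)^-1.
Proof. by rewrite -[LHS](mulgK (phi g)) -gmulfM mulVg multiplicative1 mul1g. Qed.

End Multiplicative.

Section IntegerPowers.
Variable G : groupType.

Definition expgz (x : G) (e : int) : G :=
  match e with Posz n => x ^+ n | Negz n => x ^- n.+1 end.

Lemma expgzS x e : expgz x (e + 1) = expgz x e * x.
Proof.
case: e => [n|[|n]]; first by rewrite -PoszD addn1 /= expgSr.
  by rewrite /= expg1 mulVg.
have -> : (Negz n.+1 + 1)%R = Negz n by lia.
by rewrite /= (expgS x n.+1) invgM mulgVK.
Qed.

Lemma expgzB1 x e : expgz x (e - 1) = expgz x e * x^-1.
Proof. by rewrite -{2}(subrK 1%R e) expgzS mulgK. Qed.

End IntegerPowers.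

(** * Magnus expansions and reduced products *)

Section MagnusAction.
Variables (G : groupType) (X : set G).
Hypothesis freeX : free_basis X.
Variable phi : {multiplicative G -> bijection (seq G -> int)}.
Hypothesis phiX : forall x, X x ->
  phi x = Bijection (@transvectionK G x) (@transvectionVK G x).
Implicit Types (g h x y a : G) (u w : seq G).

Definition unit_series u : int := (u == [::])%:R%R.

Definition magnus g := fwd (phi g) unit_series.

Definition magnus_coeff g u : int := (magnus g u - unit_series u)%R.

Lemma magnus1 : magnus 1 = unit_series.
Proof. by rewrite /magnus multiplicative1. Qed.

Lemma magnusM g h : magnus (g * h) = fwd (phi h) (magnus g).
Proof. by rewrite /magnus gmulfM. Qed.

Lemma magnusMx g x u : X x -> magnus (g * x) u = transvection x (magnus g) u.
Proof. by move=> Xx; rewrite magnusM (phiX Xx). Qed.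

Lemma phi_unipotent g : unipotent (fwd (phi g)).
Proof.
move: g; apply: (free_basis_ind freeX) => [|g x Xx ug|g x Xx ug]; rewrite ?multiplicative1 //.
  rewrite gmulfM (phiX Xx) -[fwd _]/(transvection x \o fwd (phi g)).
  exact/(unipotent_comp ug)/transvection_unipotent.
rewrite gmulfM multiplicativeV (phiX Xx) -[fwd _]/(transvectionV x \o fwd (phi g)).
exact/(unipotent_comp ug)/transvectionV_unipotent.
Qed.

Lemma magnus_nil g : magnus g [::] = 1%R.
Proof. by have [phi0 _] := phi_unipotent g; rewrite /magnus phi0. Qed.

Lemma magnus_coeff_nil g : magnus_coeff g [::] = 0%R.
Proof. by rewrite /magnus_coeff magnus_nil subrr. Qed.

(** The series of [g] agrees with [1] on the proper suffixes of [u], so the unipotent action of [h]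
    preserves their difference at [u]. This provides the additivity of a valued cocycle. *)
Lemma magnus_coeffM g h u :
    (forall k, drop k.+1 u != [::] -> magnus_coeff g (drop k.+1 u) = 0%R) ->
  magnus_coeff (g * h) u = (magnus_coeff g u + magnus_coeff h u)%R.
Proof.
case: u => [|y u] g0; first by rewrite !magnus_coeff_nil.
have agr : suffix_agree (magnus g) unit_series u.
  move=> k; apply/eqP; rewrite -subr_eq0 -/(magnus_coeff g _); apply/eqP.
  have [->|/g0//] := eqVneq (drop k u) [::]; exact: magnus_coeff_nil.
have [_ /(_ _ _ y u agr)] := phi_unipotent h.
rewrite /magnus_coeff magnusM -[fwd _ unit_series]/(magnus h) => agrS.
by rewrite -[fwd _ _ _](subrK (magnus h (y :: u))) agrS addrA.
Qed.

Lemma magnus_expgzS g x e u : X x ->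
  magnus (g * expgz x (e + 1)) u = transvection x (magnus (g * expgz x e)) u.
Proof. by move=> Xx; rewrite expgzS mulgA magnusMx. Qed.

Lemma magnusMz_id g x e u : X x -> ohead u != Some x ->
  magnus (g * expgz x e) u = magnus g u.
Proof.
move=> Xx; case: u => [|y u]; first by rewrite !magnus_nil.
move=> yx; have {}yx : (x == y) = false by apply: contraNF yx => /eqP ->.
have step (f : int) : magnus (g * expgz x (f + 1)) (y :: u) =
    magnus (g * expgz x f) (y :: u).
  by rewrite magnus_expgzS //= yx addr0.
elim/int_rect: e => [|n IH|n IH]; first by rewrite /= expg0 mulg1.
  by rewrite -addn1 PoszD step.
by rewrite -step -IH; congr (magnus (_ * expgz _ _) _); lia.
Qed.

(** In [(1 + x)^e = 1 + e x + ...] the higher powers of [x] do not contribute, because the monomial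
    has no repeated letter at its end. *)
Lemma magnusMz g x e y u : X x -> ohead u != Some y ->
  magnus (g * expgz x e) (y :: u) =
    (magnus g (y :: u) + (if x == y then e * magnus g u else 0))%R.
Proof.
move=> Xx uy; case: eqVneq => [xy|xy]; last first.
  by rewrite addr0 magnusMz_id //= (inj_eq Some_inj) eq_sym.
subst y; have step (f : int) : magnus (g * expgz x (f + 1)) (x :: u) =
    (magnus (g * expgz x f) (x :: u) + magnus g u)%R.
  by rewrite magnus_expgzS //= eqxx (magnusMz_id _ _ Xx uy).
elim/int_rect: e => [|n IH|n IH]; first by rewrite /= expg0 mulg1 mul0r addr0.
  by rewrite -addn1 PoszD step IH; lia.
have := step (- n.+1%:Z)%R; have -> : (- n.+1%:Z + 1 = - n%:Z)%R by lia.
by rewrite IH; lia.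
Qed.

Lemma magnus_coeff_gen x u : X x -> u != [:: x] -> magnus_coeff x u = 0%R.
Proof.
move=> Xx; case: u => [|y u] ux; first exact: magnus_coeff_nil.
rewrite /magnus_coeff -{1}[x]mul1g magnusMx // magnus1 /= addrC addKr.
have [xy|//] := eqVneq x y; move: ux; rewrite -xy.
by case: u => //; rewrite eqxx.
Qed.

Lemma magnus_coeff_gen1 x : X x -> magnus_coeff x [:: x] = 1%R.
Proof.
move=> Xx; rewrite /magnus_coeff -{1}[x]mul1g magnusMx // magnus1 /= eqxx.
by rewrite /unit_series /= add0r subr0.
Qed.

(* [syllables a u m g]: [g] is a reduced product [a ^ e * x1 ^ e1 * ... * xk ^ ek]
   with [u = [:: xk; ...; x1]] and [m = e1 * ... * ek]; here [e] may vanish but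
   the [ei] may not. *)
Inductive syllables a : seq G -> int -> G -> Prop :=
| SyllablesNil e : syllables a [::] 1 (expgz a e)
| SyllablesCons x e u m g : X x -> x != head a u -> e != 0%R ->
    syllables a u m g -> syllables a (x :: u) (m * e) (g * expgz x e).

Lemma syllables_ex a g : X a -> exists u m, syllables a u m g.
Proof.
move=> Xa.
have step u m h x e : e = 1%R \/ e = (- 1)%R -> X x -> syllables a u m h ->
    exists u' m', syllables a u' m' (h * expgz x e).
  move=> e1 Xx hs; have e0 : e != 0%R by case: e1 => ->.
  have expD y f : expgz y f * expgz y e = expgz y (f + e).
    by case: e1 => ->; rewrite ?expgzS ?expgzB1 /= expg1.
  (* A new letter either opens a syllable or changes the last exponent, deleting the syllable if it
     becomes 0. The default [a] of [head] treats the initial power of [a] as the last syllable when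
     [u] is empty. *)
  have [xu|xu] := eqVneq x (head a u); last first.
    by exists (x :: u), (m * e)%R; apply: SyllablesCons.
  case: hs xu => [f|y f u' m' k Xy yu f0 hs] /= ->.
    by rewrite expD; exists [::], 1%R; apply: SyllablesNil.
  rewrite -mulgA expD; have [->|fe] := eqVneq (f + e)%R 0%R.
    by exists u', m'; rewrite /= expg0 mulg1.
  by exists (y :: u'), (m' * (f + e))%R; apply: SyllablesCons.
move: g; apply: (free_basis_ind freeX) => [|g x Xx [u [m gs]]|g x Xx [u [m gs]]].
- by exists [::], 1%R; apply: (@SyllablesNil a 0%R).
- by have := step _ _ _ x 1%R (or_introl erefl) Xx gs; rewrite /= expg1.
- by have := step _ _ _ x (- 1)%R (or_intror erefl) Xx gs; rewrite /= expg1.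
Qed.

Lemma syllables_neq0 a u m g : syllables a u m g -> m != 0%R.
Proof. by elim=> // *; rewrite mulf_neq0. Qed.

Lemma syllables_last a u m g : syllables a u m g -> u != [::] -> last a u != a.
Proof.
elim=> // x e [|y u'] {}m {}g Xx xu e0 gs IH _ //=; exact: IH.
Qed.

(** [sorted] compares neighbours only; the final [a] keeps the monomial from starting with [a]. *)
Definition alternating a u := sorted [rel x y | x != y] (rcons u a).

Lemma alternating_cons a y u : alternating a (y :: u) =
  (y != head a u) && alternating a u.
Proof. by rewrite /alternating; case: u. Qed.

Lemma syllables_alternating a u m g : syllables a u m g -> alternating a u.
Proof. by elim=> // x e {}u {}m {}g _ xu _ _ IH; rewrite alternating_cons xu. Qed.

Lemma alternating_ohead a y u : alternating a (y :: u) -> ohead u != Some y.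
Proof.
rewrite alternating_cons => /andP[yu _]; case: u yu => //= z u.
by apply: contra => /eqP[->].
Qed.

(** Each syllable supplies at most one letter of an alternating monomial, and the initial power of
    [a] supplies none. *)
Lemma magnus_alternating0 a u m g w : X a -> syllables a u m g -> alternating a w ->
  (size u < size w)%N -> magnus g w = 0%R.
Proof.
move=> Xa gs; elim: gs w => [e|x e {}u {}m {}g Xx xu e0 gs IH] [|y w] // altw.
  move=> _; rewrite -[expgz a e]mul1g magnusMz ?(alternating_ohead altw) // magnus1.
  move: altw; rewrite alternating_cons; case: w => [|z w] /andP[ya _].
    by rewrite eq_sym (negbTE ya).
  by rewrite /unit_series /= mulr0 if_same.
move=> ltuw; rewrite magnusMz ?(alternating_ohead altw) // (IH (y :: w)) ?(ltnW ltuw) //.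
move: altw; rewrite alternating_cons => /andP[_ altw].
by rewrite IH // mulr0 if_same.
Qed.

(** The monomial [u] arises only by taking one letter, with its exponent as coefficient, from every
    syllable. *)
Lemma magnus_syllables a u m g : X a -> syllables a u m g -> magnus g u = m.
Proof.
move=> Xa; elim=> [e|x e {}u {}m {}g Xx xu e0 gs IH]; first exact: magnus_nil.
have altxu : alternating a (x :: u).
  by rewrite alternating_cons xu (syllables_alternating gs).
rewrite magnusMz ?(alternating_ohead altxu) // eqxx IH.
by rewrite (magnus_alternating0 Xa gs altxu) //= add0r mulrC.
Qed.

(** The first hypothesis leaves no syllable beyond [a ^ e], and the coefficient at [a] is then
    [e]. *)
Lemma magnus_coeff_inj a g : X a ->
    (forall u, u != [::] -> last a u != a -> magnus_coeff g u = 0%R) ->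
  magnus_coeff g [:: a] = 0%R -> g = 1.
Proof.
move=> Xa g0 ga; have [u [m gs]] := syllables_ex g Xa.
have u0 : u = [::].
  apply: contraTeq (syllables_neq0 gs) => u0; rewrite negbK.
  rewrite -(magnus_syllables Xa gs); apply/eqP.
  have := g0 u u0 (syllables_last gs u0).
  by rewrite /magnus_coeff /unit_series (negbTE u0) subr0.
move: gs; rewrite u0 => gs; inversion gs as [e|]; subst g.
move: ga; rewrite -[expgz a e]mul1g /magnus_coeff magnusMz // magnus1 eqxx.
by rewrite /unit_series /= mulr1 add0r subr0 => -> /=; rewrite expg0 mul1g.
Qed.

End MagnusAction.

(** * The well-order on monomials *)

Section WordOrder.
Variables (T : eqType) (a : T) (prec : seq T -> seq T -> Prop).

(* Words are read backwards, so [last a u] is the first letter of the monomial. *)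
Definition word_lt : seq T -> seq T -> Prop :=
  rank_lex (fun u => (last a u == a) : nat) (rank_lex size prec).

(** A nonempty suffix keeps the last letter, hence the class, and is shorter. So vanishing below [u]
    gives the hypothesis of [magnus_coeffM]. *)
Lemma word_lt_drop k u : drop k.+1 u != [::] -> word_lt (drop k.+1 u) u.
Proof.
move=> du; right; split.
  rewrite -{2}(cat_take_drop k.+1 u) last_cat.
  by case: (drop k.+1 u) du.
left; rewrite size_drop -subn_gt0; case: u du => //= y u _.
by rewrite subSS subn_gt0 ltnS leq_subr.
Qed.

Lemma word_lt_last u : last a u != a -> word_lt u [:: a].
Proof. by move=> ua; left; rewrite /= eqxx (negbTE ua). Qed.

End WordOrder.

Theorem corollary3p6 (R : realType) (G : groupType)
    (hfree : free_group G) (hnontrivial : exists g : G, g <> 1%g) :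
  exists lt : G -> G -> Prop,
    right_order lt /\ discrete_order lt /\ lexicographic R lt.
Proof.
have [X freeX] := hfree; have [g0 g0_neq1] := hnontrivial.
have [a Xa] : exists a, X a.
  (* An empty basis would generate only the trivial subgroup. *)
  apply: contra_notP g0_neq1 => /forallNP X0.
  by apply: (free_basis_generates (H := [set 1]) freeX) => [|x /X0//];
    apply/subgroupP; split=> // x y -> ->; apply: divgg.
have [phi [phiX _]] := freeX (bijection (seq G -> int))
  (fun x => Bijection (@transvectionK G x) (@transvectionVK G x)).
have [prec wo_prec] := exists_strict_well_order (seq G).
have wo : strict_well_order (word_lt a prec).
  by do 2 apply: rank_lex_well_order.
pose c := magnus_coeff phi.
have cM g h u : vanishes_below (word_lt a prec) c g u ->
    c (g * h) u = (c g u + c h u)%R.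
  by move=> gu; apply: (magnus_coeffM freeX phiX) => k /(word_lt_drop a prec)/gu.
have c_inj g : (forall u, c g u = 0%R) -> g = 1.
  by move=> cg; apply: (magnus_coeff_inj freeX phiX Xa) => [u _ _|]; apply: cg.
exists (cocycle_lt (word_lt a prec) c); split; first exact: cocycle_right_order.
split; last exact: cocycle_lexicographic.
(* The monomial [a] comes after all those not starting with [a], so vanishing up to it meets the
   hypotheses of [magnus_coeff_inj]. *)
apply: (@cocycle_discrete _ _ _ c wo cM a [:: a]).
- move=> u ua; apply: (magnus_coeff_gen freeX phiX Xa).
  apply/eqP => uE; have [irr _ _] := wo; apply: (irr u).
  by rewrite {2}uE.
- exact: (magnus_coeff_gen1 phiX Xa).
- move=> g [ga cga]; apply: (magnus_coeff_inj freeX phiX Xa) => // u _ ua.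
  by apply: ga; apply: word_lt_last.
Qed.
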